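(* For every pair $\chi<\kappa$ of regular uncountable cardinals, $\square(\kappa)$ implies $\mathrm{Pr}_1(\kappa,\kappa,\kappa,\chi)$.
   Context: Work in ZFC. For sets of ordinals $a,b$, write $a<b$ iff $\alpha<\beta$ for all $\alpha\in a$ and $\beta\in b$. For an ordinal $\sigma$, $[\kappa]^\sigma$ is the collection of all subsets of $\kappa$ of order type $\sigma$. As an exception, $[\kappa]^2:=\{(\alpha,\beta)\mid \alpha<\beta<\kappa\}$, and for a collection $\mathcal A$ of sets of ordinals, $[\mathcal A]^2:=\{(a,b)\in\mathcal A\times\mathcal A\mid a<b\}$. $\mathrm{Pr}_1(\kappa,\kappa,\theta,\chi)$ asserts the existence of a coloring $c:[\kappa]^2\rightarrow\theta$ such that for every $\sigma<\chi$, every pairwise disjoint subfamily $\mathcal A\subseteq[\kappa]^\sigma$ of size $\kappa$, and every $\tau<\theta$, there is $(a,b)\in[\mathcal A]^2$ such that $c[a\times b]=\{\tau\}$. For a set of ordinals $C$, $\mathrm{acc}(C):=\{\alpha\in C\mid \sup(C\cap\alpha)=\alpha>0\}$. For a regular uncountable cardinal $\kappa$, $\square(\kappa)$ asserts the existence of a sequence $\langle C_\alpha\mid\alpha<\kappa\rangle$ such that: (1) for every $\alpha<\kappa$, $C_\alpha$ is a closed subset of $\alpha$ with $\sup(C_\alpha)=\sup(\alpha)$; (2) for all $\alpha<\kappa$ and $\delta\in\mathrm{acc}(C_\alpha)$, $C_\alpha\cap\delta=C_\delta$; (3) there is no club $C$ in $\kappa$ such that $C\cap\alpha=C_\alpha$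 for all $\alpha\in\mathrm{acc}(C)$. *)

(* Defs.v *)
From mathcomp Require Import all_boot all_order all_classical.

Set Implicit Arguments.
Unset Strict Implicit.
Unset Printing Implicit Defensive.

Local Open Scope order_scope.
Local Open Scope card_scope.
Local Open Scope classical_set_scope.

(* Ordinals are the elements of a totally ordered type O whose order is
   assumed (in the theorem) to be a well-order. The definitions below are only
   meaningful under that assumption. An ordinal k, seen as the set of smaller
   ordinals, is [below k]; O is arbitrary, so k is an arbitrary ordinal. *)

Section Ordinals.
Context {d : Order.disp_t} {O : orderType d}.
Implicit Types (a b k mu th ch s t x y : O) (A B C : set O).

Definition below k : set O := [set x | x < k].

Definition set_lt A B : Prop := forall x y, A x -> B y -> x < y.

Definition has_order_type A s : Prop :=
  exists f : O -> O,
    (forall x y, x < s -> y < s -> x < y -> f x < f y) /\ f @` below s = A.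

Definition cofinal_in k A : Prop :=
  A `<=` below k /\ forall x, x < k -> exists2 y, A y & x <= y.

Definition is_cardinal k : Prop :=
  forall x, x < k -> ~ (below k #<= below x).

Definition regular_cardinal k : Prop :=
  [/\ is_cardinal k, infinite_set (below k)
    & forall A, cofinal_in k A -> A #= below k].

Definition regular_uncountable k : Prop :=
  regular_cardinal k /\ ~ countable (below k).

(* sup (C \cap a) = a > 0. Here [supremums A] is the set of least upper bounds
   of A in O; it is the singleton of the ordinal sup A when A is bounded (and
   sup set0 is the least ordinal 0). *)
Definition acc_point C a : Prop :=
  supremums (C `&` below a) a /\ below a !=set0.

Definition acc C : set O := [set a | C a /\ acc_point C a].

Definition closed_subset k C : Prop :=
  C `<=` below k /\ forall a, a < k -> acc_point C a -> C a.

Definition club k C : Prop := closed_subset k C /\ cofinal_in k C.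

Definition square k : Prop :=
  exists C : O -> set O,
    [/\ forall a, a < k ->
          closed_subset a (C a) /\ supremums (C a) = supremums (below a),
        forall a x, a < k -> acc (C a) x -> C a `&` below x = C x
      & ~ exists2 D : set O, club k D &
            forall a, acc D a -> D `&` below a = C a].

Definition subsets_of_type k s : set (set O) :=
  [set A | A `<=` below k /\ has_order_type A s].

(* Pr_1(k, mu, th, ch): mu is the size of the families. A coloring of [k]^2 is
   a binary function on O of which only the values c a b for a < b < k
   matter. *)
Definition Pr1 k mu th ch : Prop :=
  exists c : O -> O -> O,
    (forall a b, a < b -> b < k -> c a b < th) /\
    forall s (F : set (set O)) t, s < ch ->
      F `<=` subsets_of_type k s -> trivIset F id -> F #= below mu -> t < th ->
      exists A B : set O,
        [/\ F A, F B, set_lt A B & [set c a b | a in A & b in B] = [set t]].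

End Ordinals.

(* Main.v *)
Require Import Defs.
From mathcomp Require Import all_boot all_order all_classical.

Import Order.TTheory.

Local Open Scope order_scope.

(* Walk along the square sequence, and attach to every point [b] of a walk the
   hue [min (C_b \ eps)], which is coherent along the sequence. As the sequence
   has no thread, for a suitable [eps] each of [kappa] many hues is taken
   stationarily often at cofinality [>= chi]. Group the hues into [chi] colours.

   Given a hue [t] and a family, consider [nu] of hue [t] and cofinality
   [>= chi] below some [b] of the family. As [chi] is regular, the parts above
   [nu] of the walks from the elements of [b] have bounded colours, for
   unboundedly many [nu] with the same bound [j < chi]. Take [dl] of countable
   cofinality and [a] slightly below [dl]: the parts below [dl] of the walks to
   the elements of [a] have colours below some [k' < chi]. Only now choose
   [gam > dl] of colour [i >= j, k'], and [nu] above [gam]. The segment from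
   [nu] to [dl] is common to all walks from [b] to [a] and contains the first
   point of maximal colour, so its head, of hue [t], lies at some distance [m]
   above the peak, for all pairs at once.

   The distance [m] depends on the family. But a countable union of families is
   a family, so each [t] has an [m] serving all families, and some [m] serves
   [kappa] many hues [t]. Read off the hue [m] steps above the peak. *)

Section Combinatorics.

(** * Small and stationary sets *)

Local Open Scope card_scope.
Local Open Scope classical_set_scope.

Context {d : Order.disp_t} {O : orderType d}.
Hypothesis O_wo : wochoice.well_order (<=%O : rel O).
Implicit Types (x y z k : O).

Lemma exists_least (P : O -> Prop) x : P x ->
  exists2 z, P z & forall y, P y -> z <= y.
Proof.
move=> Px.
have [|z [[zP zle] _]] := O_wo [pred y | `[< P y >]].
  by exists x; apply/asboolP.
exists z; first exact/asboolP.
by move=> y Py; apply: zle; apply/asboolP.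
Qed.

Lemma wo_ind (P : O -> Prop) :
  (forall x, (forall y, y < x -> P y) -> P x) -> forall x, P x.
Proof.
move=> IH x; apply: contrapT => nPx.
have [z nPz zle] := @exists_least (fun y => ~ P y) x nPx.
apply: nPz; apply: IH => y yz; apply: contrapT => /zle.
by rewrite leNgt yz.
Qed.

(* For regular [k] this says that [A] has cardinality less than [k]. *)
Definition small k {T} (A : set T) : Prop :=
  forall f : T -> O, (forall i, A i -> f i < k) ->
  exists2 y, y < k & forall i, A i -> f i < y.

Lemma small_image k {T U} (A : set T) (g : T -> U) :
  small k A -> small k (g @` A).
Proof.
move=> sA f fk.
have [|y yk fy] := sA (f \o g); first by move=> i Ai; apply: fk; exists i.
by exists y => // _ [i Ai <-]; apply: fy.
Qed.

(** If [f] were unbounded on [I], its image would be cofinal in [k], hence of size [k]. *)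
Lemma reg_small {k T} (I : set T) :
  regular_cardinal k -> ~ (below k #<= I) -> small k I.
Proof.
move=> [_ _ kreg] sI f fk; apply: contrapT => nb.
apply: sI; apply: card_le_trans (card_image_le f I).
have /kreg : cofinal_in k (f @` I).
  split; first by move=> _ [i Ii <-]; apply: fk.
  move=> x xk; apply: contrapT => nx; apply: nb; exists x => // i Ii.
  by rewrite ltNge; apply/negP => xf; apply: nx; exists (f i) => //; exists i.
by rewrite card_eq_le => /andP[].
Qed.

Lemma small_below k x : regular_cardinal k -> x < k -> small k (below x).
Proof. by move=> kr xk; apply: reg_small => // ; case: kr => + _ _; apply. Qed.

Lemma small_finite k {T} (A : set T) :
  regular_cardinal k -> finite_set A -> small k A.
Proof.
move=> kr fA; apply: reg_small => // kA.
by case: kr => _ + _; apply; apply: card_le_finite fA.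
Qed.

Lemma small_nat k (A : set nat) : regular_uncountable k -> small k A.
Proof.
move=> [kr kc]; apply: reg_small => // kA; apply: kc.
exact: card_le_trans kA (card_leT A).
Qed.

(** Otherwise each [R i] fails from some point below [k] on, and these points have a common bound
    below [k]. *)
Lemma small_pigeon {k T} (I : set T) (R : T -> O -> Prop) :
  small k I ->
  (forall x, x < k -> exists y i, [/\ x <= y, y < k, I i & R i y]) ->
  exists2 i, I i &
    forall x, x < k -> exists y, [/\ x <= y, y < k & R i y].
Proof.
move=> sI H; apply: contrapT => nH.
have /choice[f fP] : forall i, exists x, I i -> x < k /\
    forall y, x <= y -> y < k -> ~ R i y.
  move=> i; have [Ii|nIi] := pselect (I i); last by exists k.
  apply: contrapT => ni; apply: nH; exists i => // x xk.
  apply: contrapT => ny; apply: ni; exists x => _; split=> // y xy yk Riy.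
  by apply: ny; exists y.
have [y yk fy] := sI f (fun i Ii => (fP i Ii).1).
have [z [i [yz zk Ii Riz]]] := H y yk.
by apply: (fP i Ii).2 Riz => //; apply: le_trans yz; apply/ltW/fy.
Qed.

Lemma small_bigcup {k T U} (I : set T) (A : T -> set U) :
  small k I -> (forall i, I i -> small k (A i)) ->
  small k (\bigcup_(i in I) A i).
Proof.
move=> sI sA f fk.
have /choice[g gP] : forall i, exists y, I i -> y < k /\
    forall u, A i u -> f u < y.
  move=> i; have [Ii|nIi] := pselect (I i); last by exists k.
  have [|y yk yP] := sA i Ii f; first by move=> u Au; apply: fk; exists i.
  by exists y.
have [y yk gy] := sI g (fun i Ii => (gP i Ii).1).
exists y => // u [i Ii Aiu].
exact: lt_trans ((gP i Ii).2 _ Aiu) (gy i Ii).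
Qed.

Lemma small_setU k {T} (A B : set T) :
  regular_cardinal k -> small k A -> small k B -> small k (A `|` B).
Proof.
move=> kr sA sB.
have -> : A `|` B = \bigcup_(b in [set: bool]) (if b then A else B).
  apply/seteqP; split=> x; last by case=> [[]] _; [left|right].
  by case=> [Ax|Bx]; [exists true|exists false].
by apply: small_bigcup => [|[] _] //; apply/small_finite/finite_finset.
Qed.

Lemma small_upto k z :
  regular_cardinal k -> z < k -> small k [set x | x <= z].
Proof.
move=> kr zk; have -> : [set x | x <= z] = below z `|` [set z].
  apply/seteqP; split=> x /=; last by case=> [/ltW|->].
  by rewrite le_eqVlt => /predU1P[->|xz]; [right|left].
apply: small_setU => //; first exact: small_below.
exact/small_finite/finite_set1.
Qed.

(* This lets [stat] below, which speaks of unary operations, be used with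
   ternary ones. *)
Lemma closure3 k (H : O -> O -> O -> O) : regular_cardinal k ->
  (forall a b c, a < k -> b < k -> c < k -> H a b c < k) ->
  exists g : O -> O, forall z, z < k -> g z < k /\
    forall a b c, a <= z -> b <= z -> c <= z -> H a b c < g z.
Proof.
move=> kr Hk.
suff /choice[g gP] : forall z, exists y, z < k -> y < k /\
    forall a b c, a <= z -> b <= z -> c <= z -> H a b c < y by exists g.
move=> z; have [zk|nzk] := pselect (z < k); last by exists z.
have /choice[h1 h1P] : forall ab : O * O, exists y, (ab.1 <= z /\ ab.2 <= z) ->
    y < k /\ forall c, c <= z -> H ab.1 ab.2 c < y.
  move=> [a b]; have [[/= az bz]|] := pselect (a <= z /\ b <= z);
    last by exists z.
  have [c cz|y yk yP] := small_upto k z kr zk (H a b).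
    by apply: Hk; apply: le_lt_trans zk.
  by exists y.
have /choice[h2 h2P] : forall a, exists y, a <= z ->
    y < k /\ forall b, b <= z -> h1 (a, b) < y.
  move=> a; have [az|] := pselect (a <= z); last by exists z.
  have [b bz|y yk yP] := small_upto k z kr zk (fun b => h1 (a, b)).
    exact: (h1P (a, b) (conj az bz)).1.
  by exists y.
have [a az|y yk yP] := small_upto k z kr zk h2; first exact: (h2P a az).1.
exists y => _; split=> // a b c az bz cz.
apply: lt_trans ((h1P (a, b) (conj az bz)).2 c cz) _.
exact: lt_trans ((h2P a az).2 b bz) (yP a az).
Qed.

(** [dl] is the least strict upper bound of the iterates of a function above [g] and the identity,
    so it is closed under [g] and has countable cofinality. *)
Lemma closure_seq k (g : O -> O) x0 : regular_uncountable k ->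
  (forall x, x < k -> g x < k) -> x0 < k ->
  exists2 dl, dl < k & exists s : nat -> O,
    [/\ s 0%N = x0, forall n, s n < dl, {homo s : m n / (m <= n)%N >-> m <= n},
        forall n x, x <= s n -> g x <= s n.+1 & 
        forall x, x < dl -> exists n, x <= s n].
Proof.
move=> ku gk x0k; have [kr _] := ku.
have [|g' g'P] := closure3 k (fun a _ _ => Order.max (g a) a) kr.
  by move=> a b c ak _ _; rewrite gt_max gk.
pose s n := iter n g' x0.
have sk n : s n < k by elim: n => //= n IH; apply: (g'P _ IH).1.
have [y0 y0k y0P] := small_nat k setT ku s (fun n _ => sk n).
have [dl dlP dlle] := exists_least (fun y => forall n, s n < y) y0
  (fun n => y0P n I).
have sS n x : x <= s n -> Order.max (g x) x < s n.+1.
  by move=> xs; apply: ((g'P _ (sk n)).2 x x x).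
exists dl; first by apply: le_lt_trans y0k; apply: dlle => n; apply: y0P.
exists s; split=> //.
- apply: homo_leq => // [x y z|n]; first exact: le_trans.
  by have := sS n _ (lexx _); rewrite gt_max => /andP[_ /ltW].
- by move=> n x /sS; rewrite gt_max => /andP[/ltW].
- move=> x xdl; apply: contrapT => nx.
  have : dl <= x.
    by apply: dlle => n; rewrite ltNge; apply/negP => xs; apply: nx; exists n.
  by rewrite leNgt xdl.
Qed.

Lemma card_le_onto {T U} {A : set T} {B : set U} (x0 : T) : A #<= B ->
  exists phi : U -> T, forall i, A i -> exists2 t, B t & phi t = i.
Proof.
case/pfcard_geP => [->|/surjfunPex[phi ->]]; first by exists (fun=> x0).
by exists phi => _ [t Bt <-]; exists t.
Qed.

Lemma regular_gt0 k : regular_cardinal k -> exists x, x < k.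
Proof.
move=> [_ kinf _]; apply: contrapT => nx; apply: kinf.
suff -> : below k = set0 by apply: finite_set0.
by apply/seteqP; split=> x //= xk; apply: nx; exists x.
Qed.

Lemma regular_onto k {T} (A : set T) : regular_cardinal k -> below k #<= A ->
  exists2 phi : T -> O, forall u, phi u < k &
    forall i, i < k -> exists2 t, A t & phi t = i.
Proof.
move=> /regular_gt0[i0 i0k] /(card_le_onto k)[phi phiP].
exists (fun u => if phi u < k then phi u else i0).
  by move=> u; case: ifP.
by move=> i ik; have [t At ti] := phiP i ik; exists t; rewrite // ti ik.
Qed.

Lemma cofinal_onto chi k (K : set O) : regular_cardinal chi ->
  regular_cardinal k -> chi <= k -> cofinal_in k K ->
  exists2 phi : O -> O, forall x, phi x < chi &
    forall i, i < chi -> exists2 t, K t & phi t = i.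
Proof.
move=> cr [_ _ kreg] chik /kreg KE; apply: regular_onto => //.
apply: (card_le_trans (B := below k)).
  by apply: subset_card_le => x /= /lt_le_trans; apply.
by move: KE; rewrite card_eq_le => /andP[].
Qed.

Lemma regular_not_small k {T} (A : set T) :
  regular_cardinal k -> below k #<= A -> ~ small k A.
Proof.
move=> kr /(regular_onto k A kr)[phi phik phiP] /(_ phi (fun i _ => phik i)).
by move=> [y /phiP[t At <-] /(_ t At)]; rewrite ltxx.
Qed.

(* For regular uncountable [k] this is stationarity: the closure points of any
   [g] form a club, and every club contains the closure points of some [g]. *)
Definition stat k (N : set O) : Prop :=
  forall g : O -> O, (forall x, x < k -> g x < k) ->
  exists2 nu, N nu & nu < k /\ forall x, x < nu -> g x < nu.

(* Fodor's lemma, for a relation instead of a regressive function. *)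
Lemma stat_pigeon {k} (N : set O) (R : O -> O -> Prop) : stat k N ->
  (forall nu, N nu -> nu < k -> exists2 x, x < nu & R nu x) ->
  exists2 x, x < k &
    forall y, y < k -> exists nu, [/\ N nu, y < nu, nu < k & R nu x].
Proof.
move=> Ns H; apply: contrapT => nH.
have /choice[g gP] : forall x, exists y, x < k -> y < k /\
    forall nu, N nu -> y < nu -> nu < k -> ~ R nu x.
  move=> x; have [xk|] := pselect (x < k); last by exists k.
  apply: contrapT => nx; apply: nH; exists x => // y yk.
  apply: contrapT => ny; apply: nx; exists y => _.
  split=> // nu Nnu ynu nuk Rnu.
  by apply: ny; exists nu.
have [nu Nnu [nuk gnu]] := Ns g (fun x xk => (gP x xk).1).
have [x xnu Rx] := H nu Nnu nuk.
exact: (gP x (lt_trans xnu nuk)).2 Nnu (gnu x xnu) nuk Rx.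
Qed.

(* The ordinals of cofinality at least [chi], together with the successors. *)
Definition highcof chi : set O :=
  [set nu | forall B : set O, small chi B -> B `<=` below nu ->
     exists2 x, x < nu & forall y, B y -> y <= x].

(** Let [nu] be least such that the closure points [E] of [g] below [nu] are not [small chi]. A
    small set cofinal in [nu] would split them into few small pieces. As a limit of [E], [nu] is
    closed under [g]. *)
Lemma highcof_stat chi k : regular_cardinal chi -> regular_uncountable k ->
  chi < k -> stat k (highcof chi).
Proof.
move=> cr ku chik g gk; have [kr _] := ku.
pose E : set O := [set e | e < k /\ forall x, x < e -> g x < e].
have Eunb x : x < k -> exists2 e, E e & x <= e.
  move=> xk; have [dl dlk [s [s0 sdl _ sS slim]]] := closure_seq k g x ku gk xk.
  exists dl; last by rewrite -s0 ltW.
  split=> // y /slim[n] /sS /le_lt_trans; exact.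
have [|phi phic phiP] := cofinal_onto chi k E cr kr (ltW chik).
  by split=> [e []|].
have /choice[e eP] : forall i, exists e, i < chi -> E e /\ phi e = i.
  move=> i; have [/phiP[e Ee ei]|] := pselect (i < chi); last by exists chi.
  by exists e.
(* As [chi < k], one [nu1] lies above closure points of all labels [i < chi]. *)
have [nu1 nu1k nu1P] := small_below k chi kr chik e
  (fun i ic => (eP i ic).1.1).
have nsnu1 : ~ small chi (E `&` below nu1).
  move=> /(_ phi)[|y yc yP]; first by move=> *; apply: phic.
  have [Ee ey] := eP y yc.
  by have := yP _ (conj Ee (nu1P y yc)); rewrite ey ltxx.
have [nu nsnu nule] :=
  exists_least (fun z => ~ small chi (E `&` below z)) nu1 nsnu1.
have above B : small chi B -> B `<=` below nu ->
    exists e, [/\ E e, e < nu & forall x, B x -> x < e].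
  move=> sB Bnu; apply: contrapT => nE; apply: nsnu.
  have -> : E `&` below nu = \bigcup_(x in B) (E `&` [set y | y <= x]).
    apply/seteqP; split=> [y [Ey ynu]|y [x Bx [Ey yx]]]; last first.
      by split=> //; apply: le_lt_trans (Bnu x Bx).
    apply: contrapT => ny; apply: nE; exists y; split=> // x Bx.
    by rewrite ltNge; apply/negP => yx; apply: ny; exists x.
  apply: small_bigcup => // x /Bnu /= xnu.
  have -> : E `&` [set y | y <= x] = (E `&` below x) `|` (E `&` [set x]).
    apply/seteqP; split=> y /=.
      by rewrite le_eqVlt => -[Ey /predU1P[<-|yx]]; [right|left].
    case=> [[Ey /ltW yx]|[Ey yx]].
      by split.
    by split=> //; rewrite yx.
  apply: small_setU => //; last exact/small_finite/finite_setIr/finite_set1.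
  by apply: contrapT => /nule; rewrite leNgt xnu.
exists nu.
  move=> B sB Bnu; have [x [_ xnu xP]] := above B sB Bnu.
  by exists x => // y /xP /ltW.
split; first exact: le_lt_trans (nule _ nsnu1) nu1k.
move=> x xnu; have [|y ->|z [[zk zP] znu xz]] := above [set x].
- exact/small_finite/finite_set1.
- exact: xnu.
- exact: lt_trans (zP x (xz x erefl)) znu.
Qed.

(** * Walks on ordinals *)

Section Walks.
Context (C : O -> set O) (k : O).
Hypothesis Cclub : forall a, a < k ->
  closed_subset a (C a) /\ supremums (C a) = supremums (below a).
Hypothesis Ccoh : forall a x, a < k -> acc (C a) x -> C a `&` below x = C x.
Implicit Types (a b g dl : O) (s : seq O).

(* The walk from [b] to [a] steps to [g = min (C b \ a)]. *)
Definition next a b g : Prop :=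
  [/\ C b g, a <= g & forall y, C b y -> a <= y -> g <= y].

Lemma next_exists a b y : C b y -> a <= y -> exists2 g, next a b g & g <= y.
Proof.
move=> Cy ay.
have [g [Cg ag] gle] := exists_least (fun y => C b y /\ a <= y) y (conj Cy ay).
by exists g; [split=> // z Cz az; apply: gle|apply: gle].
Qed.

(* The hypothesis [x < a] excludes [a = 0], where [C 1] may be empty. *)
Lemma next_total x a b : x < a -> a < b -> b < k -> exists g, next a b g.
Proof.
move=> xa ab bk; have [[Cb Ccl] Csup] := Cclub b bk.
apply: contrapT => nn.
have Ca y : C b y -> y < a.
  move=> Cy; rewrite ltNge; apply/negP => /(next_exists _ _ _ Cy)[g gP _].
  by apply: nn; exists g.
have [z0 z0b z0le] := exists_least (fun z => ubound (below b) z) b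
  (fun y yb => ltW yb).
have : supremums (C b) z0 by rewrite Csup.
move=> [_ /(_ a (fun y Cy => ltW (Ca y Cy))) z0a].
have az0 : a <= z0 by apply: z0b.
have ez : z0 = a by apply/eqP; rewrite eq_le z0a.
have : supremums (C b) a by rewrite -ez Csup.
move=> aS; suff /Ca : C b a by rewrite ltxx.
apply: Ccl => //; split; last by exists x.
have -> // : C b `&` below a = C b.
by apply/seteqP; split=> [y []|y Cy] //; split=> //; apply: Ca.
Qed.

Lemma next_lt a b g : b < k -> next a b g -> g < b.
Proof. by move=> /Cclub[[Cb _] _] [/Cb]. Qed.

Lemma next_unique a b g1 g2 : next a b g1 -> next a b g2 -> g1 = g2.
Proof.
move=> [C1 a1 l1] [C2 a2 l2]; apply/eqP.
by rewrite eq_le l1 // l2.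
Qed.

Lemma bounded_not_acc (A : set O) x y : y < x -> ~ acc_point A x ->
  exists2 z, z < x & forall w, A w -> w < x -> w <= z.
Proof.
move=> yx nacc; apply: contrapT => nb; apply: nacc; split; last by exists y.
split=> [w [_ /ltW]|u uP] //; rewrite leNgt; apply/negP => ux.
by apply: nb; exists u => // w Aw wx; apply: uP.
Qed.

Lemma acc_above (A : set O) x y : acc_point A x -> y < x ->
  exists2 w, A w & y < w < x.
Proof.
move=> [[_ lub] _] yx; apply: contrapT => nw.
suff /lub : ubound (A `&` below x) y by rewrite leNgt yx.
move=> w [Aw wx]; rewrite leNgt; apply/negP => yw.
by apply: nw; exists w => //; rewrite yw.
Qed.

Lemma acc_coherent b dl : b < k -> dl < b -> acc_point (C b) dl ->
  C b `&` below dl = C dl.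
Proof.
move=> bk db adl; apply: Ccoh => //; split=> //.
by have [[_ +] _] := Cclub b bk; apply.
Qed.

(** [C b] has points between [a] and [dl], so both minima lie below [dl], where [C b] and [C dl]
    agree. *)
Lemma next_coherent a b dl : b < k -> dl < b -> acc_point (C b) dl -> a < dl ->
  next a b = next a dl.
Proof.
move=> bk db adl al; have CE := acc_coherent b dl bk db adl.
have [w Cw /andP[aw wdl]] := acc_above _ _ _ adl al.
apply/seteqP; split=> g [Cg ag gle].
  have gdl : g < dl by apply: le_lt_trans wdl; apply: gle => //; apply: ltW.
  by split=> // [|y]; rewrite -CE // => -[/gle]. 
have [Cbg gdl] : (C b `&` below dl) g by rewrite CE.
split=> // y Cy ay; have [ydl|/(lt_le_trans gdl)/ltW//] := ltP y dl.
by apply: gle => //; rewrite -CE.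
Qed.

(** * Hues along walks *)

Section Colored.
Context (eps : O).

(* A coherent colour: [hue b = hue dl] whenever [dl] is in [acc (C b)]. *)
Definition hue b : O := xget b (next eps b).

Lemma hue_next b g : next eps b g -> hue b = g.
Proof.
move=> ng; rewrite /hue; case: xgetP => [z -> nz|/(_ g)//].
exact: next_unique nz ng.
Qed.

Lemma hue_coherent b dl : b < k -> dl < b -> acc_point (C b) dl -> eps < dl ->
  hue b = hue dl.
Proof.
move=> bk db adl el; have [w Cw /andP[aw wdl]] := acc_above _ _ _ adl el.
have [g ng _] := next_exists eps b w Cw (ltW aw).
by rewrite (hue_next b g ng) (hue_next dl g) // -(next_coherent _ b).
Qed.

(* The hues along the walk from [b] down to [a], the endpoint [a] excluded. *)
Inductive walk a : O -> seq O -> Prop :=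
| walk_end : walk a a [::]
| walk_step b g s :
    a < b -> next a b g -> walk a g s -> walk a b (hue b :: s).

Lemma walk_total x a b : x < a -> a <= b -> b < k -> exists s, walk a b s.
Proof.
move=> xa; elim/wo_ind: b => b IH.
rewrite le_eqVlt => /predU1P[<-|ab] bk; first by exists [::]; constructor.
have [g ng] := next_total x a b xa ab bk.
have gb := next_lt a b g bk ng.
have [s ws] : exists s, walk a g s.
  by apply: IH => //; [case: ng|apply: lt_trans bk].
by exists (hue b :: s); apply: walk_step ws.
Qed.

Lemma walk_inv a b s : walk a b s -> a < b ->
  exists g s', [/\ next a b g, walk a g s' & s = hue b :: s'].
Proof. by case=> [|b' g s' _ ng ws _]; [rewrite ltxx|exists g, s']. Qed.

Lemma walk_unique a b s1 s2 : walk a b s1 -> walk a b s2 -> s1 = s2.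
Proof.
move=> w1; elim: w1 s2 => [|b' g s ab ng _ IH] s2 w2.
  move E : {2}a w2 => b2 w2; case: w2 E => // b' g s ab' _ _ E.
  by rewrite E ltxx in ab'.
have [g' [s' [ng' ws' ->]]] := walk_inv _ _ _ w2 ab.
by congr (_ :: _); apply: IH; rewrite (next_unique _ _ _ _ ng ng').
Qed.

(* The walk passes through [dl], or through a [b'] with [dl] in [acc (C b')],
   from where it goes on as if it started at [dl]; as hues are coherent, the
   list of hues does not tell these cases apart. *)
Lemma walk_through dl b : eps < dl -> dl <= b -> b < k ->
  exists2 Lam, Lam < dl & exists u, forall a s, Lam < a -> a < dl ->
    walk a dl s -> walk a b (u ++ s).
Proof.
move=> el; elim/wo_ind: b => b IH.
rewrite le_eqVlt => /predU1P[<-|db] bk; first by exists eps => //; exists [::].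
have [adl|nadl] := pselect (acc_point (C b) dl).
  exists eps => //; exists [::] => a s _ al /= ws.
  have [g [t [ng wt ->]]] := walk_inv _ _ _ ws al.
  rewrite -(hue_coherent b dl) //; apply: walk_step wt.
    exact: lt_trans db.
  by rewrite (next_coherent a b dl).
(* [C b] has no point strictly between [z] and [dl], so the walks from [b] to [dl] and to any [a] in
   that gap share the first step [g]. *)
have [z zl zP] := bounded_not_acc _ _ _ el nadl.
have [g ng] := next_total eps dl b el db bk.
have gb := next_lt dl b g bk ng.
have dg : dl <= g by case: ng.
have [Lam Ll [u uP]] := IH g gb dg (lt_trans gb bk).
exists (Order.max Lam z); first by rewrite gt_max Ll.
exists (hue b :: u) => a s; rewrite gt_max => /andP[La za] al ws.
apply: (walk_step a b g); [exact: lt_trans db| |exact: uP].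
case: ng => Cg _ gle; split=> //; first exact/ltW/(lt_le_trans al).
move=> y Cy ay; have [yl|/gle] := ltP y dl; last exact.
by move: (le_trans ay (zP y Cy yl)); rewrite leNgt za.
Qed.

End Colored.

(* The only use of the nontriviality of [C]. If for every [eps] the hues taken
   stationarily often were below some [v eps], then almost every [C nu], [nu] in
   [N], would meet each [[eps, v eps)] with [eps < nu], hence accumulate at
   every smaller closure point of [v], and the [C nu] would cohere to a
   thread. *)
Lemma hue_stat (N : set O) : regular_uncountable k ->
  ~ (exists2 D : set O, club k D & forall a, acc D a -> D `&` below a = C a) ->
  (forall nu, N nu -> exists x, x < nu) ->
  stat k N ->
  exists2 eps, eps < k & cofinal_in k
    [set t | t < k /\ stat k (N `&` [set nu | eps < nu /\ hue eps nu = t])].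
Proof.
move=> [kr _] Cnt N0 Ns; apply: contrapT => nH.
pose Nt eps t : set O := N `&` [set nu | eps < nu /\ hue eps nu = t].
have /choice[v vP] : forall eps, exists y, eps < k ->
    y < k /\ forall t, y <= t -> t < k -> ~ stat k (Nt eps t).
  move=> eps; apply: contrapT => ny; apply: nH; exists eps.
    by apply: contrapT => nek; apply: ny; exists eps.
  split=> [t []//|x xk]; apply: contrapT => nx; apply: ny; exists x => _.
  by split=> // t xt tk st; apply: nx; exists t.
(* If hue [t] is not stationary for [e], no point of [Nt e t] below [k] is closed under
   [G (e, t)]. *)
have /choice[G GP] : forall et : O * O, exists g : O -> O,
    (forall x, x < k -> g x < k) /\ (~ stat k (Nt et.1 et.2) ->
    forall nu, Nt et.1 et.2 nu -> nu < k -> exists2 x, x < nu & nu <= g x).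
  move=> [e t]; have [st|nst] := pselect (stat k (Nt e t)).
    by exists id.
  apply: contrapT => ng; apply: nst => g gk.
  apply: contrapT => nn; apply: ng; exists g; split=> // _ nu Nnu nuk.
  apply: contrapT => nx; apply: nn; exists nu => //; split=> // x xnu.
  by rewrite ltNge; apply/negP => le; apply: nx; exists x.
have /choice[sc scP] : forall x, exists y, x < k -> x < y /\ y < k.
  move=> x; have [xk|] := pselect (x < k); last by exists x.
  have [|y yk yP] := small_finite k [set x] kr (finite_set1 x) id.
    by move=> _ ->.
  by exists y; split=> //; apply: yP.
have [|g gP] := closure3 k
    (fun a b c => Order.max (G (a, b) c) (Order.max (v a) (sc a))) kr.
  move=> a b c ak bk ck; rewrite !gt_max (GP (a, b)).1 // (vP a ak).1 //.
  by case: (scP a ak).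
pose good nu := N nu /\ nu < k /\ forall x, x < nu -> g x < nu.
have goodP nu a b c : good nu -> a < nu -> b < nu -> c < nu ->
    [/\ G (a, b) c < nu, v a < nu & sc a < nu].
  move=> [_ [nuk gnu]] an bn cn.
  pose z := Order.max a (Order.max b c).
  have zn : z < nu by rewrite !gt_max an bn.
  have [_ /(_ a b c)] := gP z (lt_trans zn nuk).
  rewrite !le_max !lexx ?orbT => /(_ isT isT isT).
  rewrite !gt_max => /and3P[h1 h2 h3].
  by split; apply: lt_trans (gnu z zn).
have goodunb x : x < k -> exists2 nu, good nu & x < nu.
  move=> xk; have [y yk|nu Nnu [nuk gnu]] := Ns (fun y => Order.max (g y) x).
    by rewrite gt_max (gP y yk).1.
  exists nu; last first.
    by have [y yn] := N0 nu Nnu; have := gnu y yn; rewrite gt_max => /andP[].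
  split=> //; split=> // y /gnu.
  by rewrite gt_max => /andP[].
(* A hue [t >= v e] of [nu] would not be stationary, but [nu] is closed under [G (e, t)]. *)
have goodC e nu : good nu -> e < nu -> (exists x, x < e) ->
    exists t, [/\ C nu t, e <= t & t < v e].
  move=> gnu en [x xe]; have [Nnu [nuk _]] := gnu.
  have ek := lt_trans en nuk.
  have [t nt] := next_total x e nu xe en nuk.
  have tn := next_lt e nu t nuk nt.
  have [Ct et _] := nt; exists t; split=> //.
  rewrite ltNge; apply/negP => vt.
  have nst : ~ stat k (Nt e t).
    by apply: (vP e ek).2 => //; apply: lt_trans nuk.
  have [|y yn] := (GP (e, t)).2 nst nu _ nuk.
    by split=> //; split=> //; apply: hue_next.
  have [+ _ _] := goodP nu e t y gnu en tn yn.
  by move=> /lt_le_trans h /h; rewrite ltxx.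
have goodE nu nu' : good nu -> good nu' -> nu < nu' ->
    C nu' `&` below nu = C nu.
  move=> gnu gnu' nn'; have [_ [nuk' _]] := gnu'.
  have [x0 x0nu] := N0 nu gnu.1.
  apply: acc_coherent => //; split; last by exists x0.
  split=> [w [_ /ltW]|u uP] //; rewrite leNgt; apply/negP => unu.
  have uk := lt_trans (lt_trans unu nn') nuk'.
  have [usc _] := scP u uk.
  have [_ _ scn] := goodP nu u u u gnu unu unu unu.
  have [t [Ct st tv]] : exists t, [/\ C nu' t, sc u <= t & t < v (sc u)].
    by apply: goodC => //; [apply: lt_trans nn'|exists u].
  have [_ vn _] := goodP nu (sc u) u u gnu scn unu unu.
  have := uP t (conj Ct (lt_trans tv vn)).
  by rewrite leNgt (lt_le_trans usc st).
pose D := \bigcup_(nu in good) C nu.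
have DE nu : good nu -> D `&` below nu = C nu.
  move=> gnu; have [_ [nuk _]] := gnu; have [[Cb _] _] := Cclub nu nuk.
  apply/seteqP; split=> [x [[nu' gnu' Cx] xnu]|x Cx]; last first.
    by split; [exists nu|exact: Cb].
  have [lt|lt|->//] := ltgtP nu nu'.
    by rewrite -(goodE nu nu').
  by move: Cx; rewrite -(goodE nu' nu) // => -[].
have accD a : a < k -> acc_point D a -> D a /\ D `&` below a = C a.
  move=> ak aD; have [nu gnu anu] := goodunb a ak.
  have [_ [nuk _]] := gnu; have [[_ Ccl] _] := Cclub nu nuk.
  have DaE : D `&` below a = C nu `&` below a.
    rewrite -DE // -setIA; congr (_ `&` _); apply/seteqP; split=> [x xa|x []//].
    by split=> //; apply: lt_trans xa anu.
  have aC : acc_point (C nu) a by move: aD; rewrite /acc_point DaE.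
  split; last by rewrite DaE (acc_coherent nu a).
  by exists nu => //; apply: Ccl.
apply: Cnt; exists D.
  split; first split.
  - by move=> x [nu [_ [nuk _]]] /(Cclub nu nuk).1.1 /= /lt_trans; apply.
  - by move=> a ak /(accD a ak)[].
  - split=> [x [nu [_ [nuk _]]]|x xk].
      by move=> /(Cclub nu nuk).1.1 /= /lt_trans; apply.
    have [sx sk] := scP x xk.
    have [nu gnu snu] := goodunb (sc x) sk.
    have [|t [Ct st _]] := goodC (sc x) nu gnu snu; first by exists x.
    by exists t; [exists nu|apply: le_trans st; apply: ltW].
move=> a [[nu [Nnu [nuk gnu]] Ca] aD].
apply: (accD a _ aD).2.
exact: lt_trans ((Cclub nu nuk).1.1 a Ca) nuk.
Qed.

(** * The colouring *)

Section Coloring.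
Context (chi eps : O) (phi : O -> O).
Hypothesis chi_reg : regular_uncountable chi.
Hypothesis k_reg : regular_uncountable k.
Hypothesis chi_k : chi < k.
Hypothesis phi_chi : forall x, phi x < chi.
Hypothesis eps_k : eps < k.

Definition peak s : nat := find (fun z => all (fun y => phi y <= phi z) s) s.

(** Hues are listed from the top of the walk, so smaller indices lie higher. *)
Definition readout m s : O := nth k s (peak s - m).

Lemma has_peak s : s != [::] ->
  has (fun z => all (fun y => phi y <= phi z) s) s.
Proof.
elim: s => // x s IH _; have [->|/IH/hasP[z zs /allP zP]] := eqVneq s [::].
  by rewrite /= lexx.
have [xz|zx] := leP (phi x) (phi z).
  by apply/hasP; exists z; rewrite ?inE ?zs ?orbT //= xz; apply/allP.
rewrite /= lexx /=; apply/orP; left; apply/allP => y /zP yz.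
exact: le_trans (ltW zx).
Qed.

(** As [q] beats [u] and [v], the first maximum of the whole list is that of [r]; going back
    [peak r] places reaches the head of [r]. *)
Lemma readout_cat (u r v : seq O) (q : O) : q \in r ->
  (forall y, y \in u -> phi y < phi q) ->
  (forall y, y \in v -> phi y < phi q) ->
  readout (peak r) (u ++ r ++ v) = head k r.
Proof.
move=> qr uq vq; pose s := u ++ r ++ v.
have rn : r != [::] by case: r qr {s}.
pose p (t : seq O) z := all (fun y => phi y <= phi z) t.
have pE : {in r, p s =1 p r}.
  move=> z zr; rewrite /p /s !all_cat.
  case rP : (all _ r); rewrite ?andbF //=.
  have qz : phi q <= phi z by move/allP: rP; apply.
  apply/andP; split; apply/allP => y.
    by move=> /uq /lt_le_trans /(_ qz) /ltW.
  by move=> /vq /lt_le_trans /(_ qz) /ltW.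
have sE : peak s = (size u + peak r)%N.
  rewrite /peak -/(p s) -/(p r) {2}/s find_cat ifN; last first.
    apply/hasPn => z zu; apply/negP => /allP /(_ q).
    by rewrite !mem_cat qr orbT leNgt uq // => /(_ isT).
  rewrite find_cat (eq_in_has pE) (has_peak r rn); congr (_ + _)%N.
  exact: eq_in_find.
rewrite /readout -/s sE addnK /s nth_cat ltnn subnn.
by case: r rn {qr s pE sE}.
Qed.

Definition col a b : seq O := xget [::] (walk eps a b).

Lemma walk_col a b s : walk eps a b s -> col a b = s.
Proof.
move=> ws; rewrite /col; case: xgetP => [t -> wt|/(_ s)//].
exact: walk_unique wt ws.
Qed.

Lemma seq_bound s : exists2 j, j < chi & forall x, x \in s -> phi x < j.
Proof.
have [cr _] := chi_reg.
have [j jc jP] := small_finite chi _ cr (finite_seq s) phi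
  (fun x _ => phi_chi x).
by exists j.
Qed.

Lemma family_bound (B : set O) (u : O -> seq O) : small chi B ->
  exists2 j, j < chi & forall b x, B b -> x \in u b -> phi x < j.
Proof.
move=> sB; have /choice[j jP] : forall b, exists j, j < chi /\
    forall x, x \in u b -> phi x < j.
  by move=> b; have [j] := seq_bound (u b); exists j.
have [y yc yP] := sB j (fun b _ => (jP b).1).
exists y => // b x Bb xu; exact: lt_trans ((jP b).2 x xu) (yP b Bb).
Qed.

(** Unlike disjoint families of a fixed order type, these are stable under the countable unions of
    members taken in [realizes_uniform]. *)
Definition family (A : set (set O)) : Prop :=
  (forall B, A B -> small chi B /\ exists2 y, y < k & B `<=` below y) /\
  (forall x, x < k -> exists2 B, A B & forall y, B y -> x < y).

Definition hues t : set O :=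
  highcof chi `&` [set nu | eps < nu /\ hue eps nu = t].

Definition realizes m A t : Prop := exists B1 B2 : set O,
  [/\ A B1, A B2, set_lt B1 B2 &
    forall a b, B1 a -> B2 b -> readout m (col a b) = t].

(* The walks from [b] in [B] to points slightly below [nu] begin with a part
   depending on [b], of colours below [j], and then follow the walk from
   [nu]. *)
Definition upper A nu Lam j : Prop := exists B : set O,
  [/\ A B, forall b, B b -> nu < b & forall b, B b -> exists u,
    (forall a s, Lam < a -> a < nu -> walk eps a nu s ->
       walk eps a b (u ++ s)) /\ forall x, x \in u -> phi x < j].

(** Each [b] in [B] has its own bound below [nu]; as [B] is small and [nu] is in [highcof chi], one
    bound serves all. *)
Lemma upper_exists A nu : family A -> highcof chi nu -> eps < nu -> nu < k ->
  exists2 Lam, Lam < nu & exists2 j, j < chi & upper A nu Lam j.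
Proof.
move=> [Asm Aunb] nuc en nuk.
have [B AB nuB] := Aunb nu nuk; have [sB [y yk By]] := Asm B AB.
have /choice[f fP] : forall b, exists Lu : O * seq O, B b ->
    Lu.1 < nu /\ forall a s, Lu.1 < a -> a < nu -> walk eps a nu s ->
       walk eps a b (Lu.2 ++ s).
  move=> b; have [Bb|] := pselect (B b); last by exists (k, [::]).
  have [Lam Ln [u uP]] := walk_through eps nu b en (ltW (nuB b Bb))
    (lt_trans (By b Bb) yk).
  by exists (Lam, u).
have [|Lam Ln LP] := nuc ((fst \o f) @` B) (small_image _ _ _ sB).
  by move=> _ [b /fP[? _] <-].
have [j jc jP] := family_bound B (snd \o f) sB.
exists Lam => //; exists j => //; exists B; split=> // b Bb.
exists (f b).2; split=> [a s La an ws|x]; last exact: jP.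
apply: (fP b Bb).2 => //; apply: le_lt_trans La.
by apply: LP; exists b.
Qed.

(** Fodor's lemma fixes [Lam]; then the pigeonhole principle fixes [j], as [chi < k]. *)
Lemma upper_uniform A N : family A ->
  N `<=` highcof chi `&` [set nu | eps < nu] ->
  stat k N ->
  exists2 Lam, Lam < k & exists2 j, j < chi & forall x, x < k ->
    exists nu, [/\ x <= nu, nu < k, N nu & upper A nu Lam j].
Proof.
move=> fA Nc Ns.
have [|Lam Lk LP] := stat_pigeon N
    (fun nu Lam => exists2 j, j < chi & upper A nu Lam j) Ns.
  by move=> nu /Nc[/= nuc en] nuk; apply: upper_exists.
exists Lam => //.
have [||j jc jP] := small_pigeon (below chi)
    (fun j nu => N nu /\ upper A nu Lam j) (k := k).
- by apply: small_below => //; case: k_reg.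
- move=> x /LP[nu [Nnu xnu nuk [j jc uj]]]; exists nu, j.
  by split=> //; apply: ltW.
exists j => // x /jP[nu [xnu nuk [Nnu unu]]].
by exists nu.
Qed.

(** Meant for segments [w] that may be empty, where [q] is [h] itself. *)
Lemma head_mem (w v s : seq O) h q : w ++ h :: v = q :: s -> q \in rcons w h.
Proof. by case: w => [|x w] [->] _; rewrite ?inE ?eqxx. Qed.

Lemma realizes_family A t : family A -> stat k (hues t) ->
  (forall i, i < chi -> exists2 t', phi t' = i & stat k (hues t')) ->
  exists m, realizes m A t.
Proof.
move=> fA ts Ts; have [cr _] := chi_reg; have [kr _] := k_reg.
have [|Lam0 L0k [j jc NP]] := upper_uniform A (hues t) fA _ ts.
  by move=> nu [? []].
pose mid i gam Lam := exists nu w, [/\ phi (hue eps gam) = i, gam <= nu, nu < k,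
  hue eps nu = t /\ upper A nu Lam0 j & forall a s, Lam < a -> a < gam ->
    walk eps a gam s -> walk eps a nu (w ++ s)].
(* By Fodor's lemma, [Lam] depends on the colour [i] only, so that [dl] can be taken above all
   [Lam i] before [i] is known. *)
have /choice[Lam LamP] : forall i, exists Lam, i < chi -> Lam < k /\
    forall x, x < k -> exists gam,
      [/\ eps < gam, x < gam, gam < k & mid i gam Lam].
  move=> i; have [/Ts[t' ti t's]|] := pselect (i < chi); last by exists k.
  have [|Lam Lk LP] := stat_pigeon (hues t') (mid i) t's.
    move=> gam [_ [eg hg]] gk; have [nu [gn nuk [_ [_ ht]] un]] := NP gam gk.
    have [Lam Lg [w wP]] := walk_through eps gam nu eg gn nuk.
    by exists Lam => //; exists nu, w; split=> //; rewrite hg.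
  exists Lam => _; split=> // x /LP[gam [[_ [eg _]] xg gk mg]].
  by exists gam.
have [Ls Lsk LsP] := small_below k chi kr chi_k Lam (fun i ic => (LamP i ic).1).
have [Asm Aunb] := fA.
have /choice[g gP] : forall x, exists y, x < k -> y < k /\
    exists2 B, A B & forall z, B z -> x < z < y.
  move=> x; have [xk|] := pselect (x < k); last by exists k.
  have [B AB xB] := Aunb x xk; have [_ [y yk By]] := Asm B AB.
  by exists y => _; split=> //; exists B => // z Bz; rewrite xB // By.
pose x0 := Order.max eps (Order.max Lam0 Ls).
have x0k : x0 < k by rewrite !gt_max eps_k L0k.
have [dl dlk [s [s0 sdl smono sS slim]]] :=
  closure_seq k g x0 k_reg (fun x xk => (gP x xk).1) x0k.
have x0s n : x0 <= s n by rewrite -s0 smono.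
have edl : eps < dl.
  by apply: le_lt_trans (sdl 0%N); rewrite s0 le_max lexx.
pose low n i := exists gam w, [/\ eps < gam, dl < gam, gam < k,
  mid i gam (Lam i) & forall a s', s n < a -> a < dl ->
    walk eps a dl s' -> walk eps a gam (w ++ s')].
(* As [chi] is uncountable and regular, one [n] serves unboundedly many colours [i]; so [B1] can be
   chosen above [s n] before [i]. *)
have [||n _ nP] := small_pigeon [set: nat] low (k := chi).
- exact: small_nat.
- move=> i ic; have [Lk /(_ dl dlk)[gam [eg dg gk mg]]] := LamP i ic.
  have [L2 L2d [w wP]] := walk_through eps dl gam edl (ltW dg) gk.
  have [n Ln] := slim L2 L2d.
  exists i, n; split=> //; exists gam, w; split=> // a s' sa; apply: wP.
  exact: le_lt_trans sa.
have snk : s n < k by apply: lt_trans dlk.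
have [gk [B1 AB1 B1P]] := gP (s n) snk.
have B1dl a : B1 a -> a < dl.
  move=> /B1P/andP[_ /lt_le_trans]; apply.
  exact: le_trans (sS n _ (lexx _)) (ltW (sdl _)).
have sB1 a : B1 a -> s n < a by move=> /B1P/andP[].
have eB1 a : B1 a -> eps < a.
  move=> /sB1; apply: le_lt_trans; apply: le_trans (x0s n).
  by rewrite le_max lexx.
have [kk kkc kkP] := family_bound B1 (fun a => col a dl) (Asm B1 AB1).1.
have [|i [jki ic [gam [w' [eg dg gmk mg w'P]]]]] := nP (Order.max j kk).
  by rewrite gt_max jc.
have [nu [w [hi gn nuk [ht [B2 [AB2 nuB2 B2P]]] wP]]] := mg.
(* The common segment. Including [hue eps dl] gives it head [hue eps nu] even if [w] and [w'] are
   empty. *)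
pose x := w ++ rcons w' (hue eps dl).
exists (peak x), B1, B2; split=> //.
  move=> a b /B1dl adl /nuB2; apply: lt_trans; apply: lt_le_trans gn.
  exact: lt_trans dg.
move=> a b B1a B2b.
have ad := B1dl a B1a; have ea := eB1 a B1a; have sa := sB1 a B1a.
have ag := lt_trans ad dg; have an := lt_le_trans ag gn.
have x0a := le_lt_trans (x0s n) sa.
have [sd wd] := walk_total eps eps a dl ea (ltW ad) dlk.
have [_ [v [_ _ sdE]]] := walk_inv _ _ _ _ wd ad.
have wg : walk eps a gam (w' ++ sd) by apply: w'P.
have wn : walk eps a nu (w ++ w' ++ sd).
  apply: wP => //; apply: le_lt_trans x0a.
  by rewrite !le_max (ltW (LsP i _)) ?orbT.
have [u [uP uj]] := B2P b B2b.
have wb : walk eps a b (u ++ w ++ w' ++ sd).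
  by apply: uP => //; apply: le_lt_trans x0a; rewrite !le_max lexx orbT.
have xv : w ++ w' ++ sd = x ++ v by rewrite /x sdE -catA cat_rcons.
move: jki; rewrite ge_max => /andP[ji ki].
rewrite (walk_col _ _ _ wb) xv (readout_cat u x v (hue eps gam)).
- have [_ [z [_ _ zE]]] := walk_inv _ _ _ _ wn an.
  move: zE; rewrite xv ht /x; case: (w) => [|? ?] /=; last by case.
  by case: (w') => [|? ?] /=; case.
- have [_ [z [_ _ zE]]] := walk_inv _ _ _ _ wg ag.
  by rewrite /x mem_cat (head_mem _ v z) ?orbT // -sdE.
- by move=> y /uj; rewrite hi => /lt_le_trans; apply.
- move=> y yv; rewrite hi; apply: lt_le_trans ki; apply: (kkP a) => //.
  by rewrite (walk_col _ _ _ wd) sdE inE yv orbT.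
Qed.

(** Given a bad family [A m] for each [m], take unions of one member from each. The resulting family
    realizes some [m], and then so does [A m]. *)
Lemma realizes_uniform t : stat k (hues t) ->
  (forall i, i < chi -> exists2 t', phi t' = i & stat k (hues t')) ->
  exists m, forall A, family A -> realizes m A t.
Proof.
move=> ts Ts; apply: contrapT => nm.
have /choice[A AP] : forall m, exists A, family A /\ ~ realizes m A t.
  move=> m; apply: contrapT => nA; apply: nm; exists m => A fA.
  by apply: contrapT => nr; apply: nA; exists A.
pose A' : set (set O) := [set B | exists2 f : nat -> set O,
  forall m, A m (f m) & B = \bigcup_m f m].
have [|m [B1 [B2 [[f1 f1A ->] [f2 f2A ->] B12 Bt]]]] :=
  realizes_family A' t _ ts Ts.
  split=> [B [f fA ->]|x xk].
    split.
      apply: small_bigcup => [|m _]; first exact: small_nat.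
      by have [[/(_ _ (fA m))[]]] := AP m.
    have /choice[y yP] : forall m, exists y, y < k /\ f m `<=` below y.
      by move=> m; have [[/(_ _ (fA m))[_ [y]]]] := AP m; exists y.
    have [z zk zP] := small_nat k setT k_reg y (fun m _ => (yP m).1).
    exists z => // b [m _ /(yP m).2 /lt_trans]; apply; exact: zP.
  have /choice[f fP] : forall m, exists B, A m B /\ forall y, B y -> x < y.
    by move=> m; have [[_ /(_ x xk)[B]]] := AP m; exists B.
  exists (\bigcup_m f m); first by exists f => // m; case: (fP m).
  by move=> y [m _ /(fP m).2].
apply: (AP m).2; exists (f1 m), (f2 m); split=> //.
  by move=> a b fa fb; apply: B12; exists m.
by move=> a b fa fb; apply: Bt; exists m.
Qed.

End Coloring.
End Walks.

(** * Disjoint families and the theorem *)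

(** By disjointness each [y <= x] lies in at most one member, so few members meet the ordinals up to
    [x]. Empty members are dropped because the colour [t] must be attained. *)
Lemma disjoint_family chi kappa s (F : set (set O)) :
  regular_uncountable chi -> regular_uncountable kappa -> chi < kappa ->
  s < chi -> F `<=` subsets_of_type kappa s -> trivIset F id ->
  F #= below kappa ->
  family kappa chi (F `&` [set B | B !=set0]).
Proof.
move=> [cr _] [kr _] chik schi Fs tF FE.
split=> [B [/Fs[Bk [f [_ fB]]] _]|x xk].
  split; first by rewrite -fB; apply: small_image; apply: small_below.
  have sB : small kappa B.
    rewrite -fB; apply: small_image; apply: small_below => //.
    exact: lt_trans chik.
  by have [y yk yP] := sB id Bk; exists y.
apply: contrapT => nB.
suff : small kappa F.
  apply: regular_not_small => //.
  by move: FE; rewrite card_eq_le => /andP[].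
have -> : F = \bigcup_(y in [set y | y <= x])
    ((F `&` [set B | B y]) `|` (F `&` [set set0])).
  apply/seteqP; split=> [B FB|B [y _ [[]|[]]]] //.
  have [[y By]|B0] := pselect (B !=set0); last first.
    by exists x => /=; [|right; split=> //; apply/eqP/negPn/negP => /set0P].
  have [[z Bz zx]|nz] := pselect (exists2 z, B z & z <= x).
    by exists z => //; left.
  case: nB; exists B; first by split=> //; exists y.
  by move=> z Bz; rewrite ltNge; apply/negP => zx; apply: nz; exists z.
apply: small_bigcup => [|y _]; first exact: small_upto.
apply: small_setU => //; apply: small_finite => //; last first.
  exact/finite_setIr/finite_set1.
have [[B [FB By]]|nBy] := pselect (exists B, F B /\ B y).
  apply: sub_finite_set (finite_set1 B) => B' [FB' B'y].
  by apply: tF => //; exists y.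
suff -> : F `&` [set B | B y] = set0 by apply: finite_set0.
by apply/seteqP; split=> B // [FB By]; case: nBy; exists B.
Qed.

End Combinatorics.

Theorem theoremA (d : Order.disp_t) (O : orderType d)
    (O_wo : wochoice.well_order (<=%O : rel O)) (chi kappa : O) :
  chi < kappa -> regular_uncountable chi -> regular_uncountable kappa ->
  square kappa -> Pr1 kappa kappa kappa chi.
Proof.
move=> chik chiu ku [C [Cclub Ccoh Cnt]].
have [cr _] := chiu; have [kr _] := ku.
have N0 nu : highcof chi nu -> exists x, x < nu.
  move=> /(_ set0)[].
  - exact/small_finite/finite_set0.
  - by [].
  - by move=> x xnu _; exists x.
have [eps epsk K0cof] := hue_stat O_wo C kappa Cclub Ccoh (highcof chi) ku
  Cnt N0 (highcof_stat O_wo chi kappa cr ku chik).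
have [phi phic phiP] := cofinal_onto chi kappa _ cr kr (ltW chik) K0cof.
have Ts i : i < chi -> exists2 t, phi t = i & stat kappa (hues C chi eps t).
  by move=> /phiP[t [_ ts] ti]; exists t.
pose K m t := stat kappa (hues C chi eps t) /\
  forall A, family kappa chi A -> realizes C kappa eps phi m A t.
(* Each suitable hue has its own distance; as [kappa] is uncountable and regular, one [m] serves
   cofinally many. *)
have [||m _ mP] := small_pigeon (k := kappa) setT K.
- exact: small_nat.
- move=> x /K0cof.2[t [tk ts] xt].
  have [m mP] := realizes_uniform O_wo C kappa Cclub Ccoh chi eps phi chiu ku
    chik phic epsk t ts Ts.
  by exists t, m.
(* [pi] relabels the hues served by [m] so that every colour below [kappa] occurs. *)
have [|pi pik piP] := cofinal_onto kappa kappa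
    [set t | t < kappa /\ K m t]%classic kr kr (lexx _).
  split=> [t []//|x /mP[t [xt tk Kt]]].
  by exists t.
exists (fun a b => pi (readout kappa phi m (col C eps a b))); split=> // s F t.
move=> schi Fs tF FE /piP[t' [_ [_ /(_ _ (disjoint_family chi kappa s F chiu ku
  chik schi Fs tF FE))]]].
move=> [A [B [[FA [a0 Aa0]] [FB [b0 Bb0]] AB ABt]]] pit.
exists A, B; split=> //; apply/seteqP; split=> [_ [a Aa [b Bb <-]]|_ ->] /=.
  by rewrite (ABt a b).
by exists a0 => //; exists b0 => //; rewrite (ABt a0 b0).
Qed.
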